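(* Let $\Omega\subset\mathbb{R}^d$ be compact, let $p\in(1,\infty)$, and let $V=\{V_j(\Omega)\}_{j\in\mathbb{N}}$ be a multiresolution analysis with properties MRA1), MRA2), MRA3) listed in the context, with projectors $P_j$. Then for every $j\in\mathbb{N}$ there exists $\Delta_j>0$ (large enough) such that for every $\Delta_j$-dense sampling set $X_j=\{x_{j,\ell}\}_{\ell=0}^{M_j}\subset\Omega$ and every partition $\Psi_j=\{\psi_\ell\}_{\ell=0}^{M_j}$ associated to $X_j$, every function $f_j\in V_j(\Omega)$ can be exactly recovered from its samples $\{f_j(x_{j,\ell})\}_{\ell=0}^{M_j}$ by the iterative algorithm $$f_j^{(0)}=P_jQ_{\Psi_j,X_j}f_j,\qquad f_j^{(n+1)}=P_jQ_{\Psi_j,X_j}(f_j-f_j^{(n)})+f_j^{(n)},\quad n\ge 0 .$$ Precisely, $f_j=\lim_{n\to\infty}f_j^{(n)}$ uniformly on $\Omega$, and hence also in $L^q(\Omega)$ for all $q\in[1,\infty]$. Moreover, for every $f\in L^p(\Omega)$, setting $f_j=P_jf$ and letting $f_j^{(n)}$ be defined by the iteration $f_j^{(0)}=P_jQ_{\Psi_j,X_j}f_j$, $f_j^{(n+1)}=P_jQ_{\Psi_j,X_j}(f_j-f_j^{(n)})+f_j^{(n)}$, $n\ge0$, from the samples $\{f_j(x_{j,\ell})\}_{\ell=0}^{M_j}$ on such a $\Delta_j$-dense set (for each $j$), one has $$f=\lim_{j\to\infty}\lim_{n\to\infty}f_j^{(n)}\quad\text{in } L^p(\Omega).$$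
   Context: Setting. $\Omega\subset\mathbb{R}^d$ is compact, $|\Omega|$ is its Lebesgue measure, $\chi_\Omega$ is the constant function $1$ on $\Omega$, and $B_\delta(x)$ is the ball of center $x$ and radius $\delta$. $C^1(\Omega,\mathbb{R}_+)$ denotes the nonnegative continuously differentiable functions on $\Omega$ (restrictions to $\Omega$ of functions that are $C^1$ in a neighbourhood of $\Omega$). MRA1) $V=\{V_j(\Omega)\}_{j\in\mathbb{N}}$ are finite dimensional spaces such that for all $q\in(1,\infty)$: $\chi_\Omega\in V_0(\Omega)\subset V_1(\Omega)\subset\dots\subset V_j(\Omega)\subset\dots\subset L^q(\Omega)$ and $\bigcup_jV_j(\Omega)$ is dense in $L^q(\Omega)$. MRA2) Each $V_j(\Omega)$ has a basis $\Phi_j=\{\phi_{j,0},\dots,\phi_{j,N_j}\}\subset C^1(\Omega,\mathbb{R}_+)$ such that $\Phi_{j-1}=A_j\Phi_j$ for a suitable (stochastic) real scaling matrix $A_j$ of size $(N_{j-1}+1)\times(N_j+1)$, and $2^{-dj/2}\sum_{k=0}^{N_j}\phi_{j,k}\equiv1$ for all $j$. Moreover there are $C>0$ and $m\in\mathbb{N}$, independent of $j$ and $k$, such that $\operatorname{diam}(\operatorname{supp}\phi_{j,k})\le C2^{-j}$, $\#\{k:\operatorname{supp}(\phi_{j,k})\cap\operatorname{supp}(\phi_{j,k'})\ne\emptyset\}\le m$ for all $k'$, and $\|\nabla\phi_{j,k}\|_\infty\le C2^{j(d/2+1)}$. MRA3) For each $j$, $P_j:L^p(\Omega)\to V_j(\Omega)$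 is a linear projector ($P_jf=f$ for all $f\in V_j(\Omega)$) which is bounded with respect to the sup-norm on bounded functions (in particular from $C(\Omega)$ to $V_j(\Omega)$, both with the sup-norm), and $f=\lim_{j\to\infty}P_jf$ in $L^p(\Omega)$ for all $f\in L^p(\Omega)$. Sampling sets. A finite set $X=\{x_\ell\}_{\ell=0}^M\subset\Omega$ is called $\Delta$-dense ($\Delta>0$) if, with $\delta=\Delta^{-1}$, $\Omega=\big(\bigcup_{\ell=0}^MB_\delta(x_\ell)\big)\cap\Omega$. A partition associated to a $\Delta$-dense set $X$ is a set $\Psi=\{\psi_\ell\}_{\ell=0}^M\subset L^\infty(\Omega)$ with $0\le\psi_\ell\le1$, $\operatorname{supp}(\psi_\ell)\subset B_\delta(x_\ell)$ and $\sum_{\ell=0}^M\psi_\ell\equiv1$ on $\Omega$. The quasi-interpolation operator is $Q_{\Psi,X}f=\sum_{\ell=0}^Mf(x_\ell)\psi_\ell$ for $f\in C(\Omega)$. *)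

(* Defs.v *)
From HB Require Import structures.
From mathcomp Require Import all_boot all_order all_algebra.
From mathcomp Require Import all_classical all_reals all_analysis.

Set Implicit Arguments.
Unset Strict Implicit.
Unset Printing Implicit Defensive.

Import Order.TTheory GRing.Theory Num.Theory.
Import numFieldNormedType.Exports.

Local Open Scope classical_set_scope.
Local Open Scope ring_scope.

(* MathComp-Analysis has no Lebesgue measure on R^d for general d: it is built
   here by the Caratheodory construction from the Lebesgue outer measure, the
   infimum of the total volume of the countable covers by closed boxes. *)
Section lebesgue_outer.
Context (R : realType) (d : nat).
Implicit Types (A : set 'rV[R]_d) (B : set ('rV[R]_d * 'rV[R]_d)).

Definition box (ab : 'rV[R]_d * 'rV[R]_d) : set 'rV[R]_d :=
  [set x | forall i, ab.1 0 i <= x 0 i <= ab.2 0 i].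

Definition box_volume (ab : 'rV[R]_d * 'rV[R]_d) : R :=
  \prod_(i < d) Num.max 0 (ab.2 0 i - ab.1 0 i).

Definition box_cover A : set (set ('rV[R]_d * 'rV[R]_d)) :=
  [set B | countable B /\ A `<=` \bigcup_(ab in B) box ab].

Local Open Scope ereal_scope.

Definition lebesgue_outer A : \bar R :=
  ereal_inf [set \esum_(ab in B) (box_volume ab)%:E | B in box_cover A].

Lemma box_volume_ge0 ab : 0 <= (box_volume ab)%:E.
Proof. by rewrite lee_fin prodr_ge0// => i _; rewrite le_max lexx. Qed.

Lemma lebesgue_outer_ge0 A : 0 <= lebesgue_outer A.
Proof.
apply: le_ereal_inf_tmp => _ [B _ <-].
by apply: esum_ge0 => ab _; exact: box_volume_ge0.
Qed.

Lemma lebesgue_outer0 : lebesgue_outer set0 = 0.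
Proof.
apply/eqP; rewrite eq_le lebesgue_outer_ge0 andbT.
apply: ereal_inf_lbound; exists set0; last exact: esum_set0.
by split; [exact: countable0|exact: sub0set].
Qed.

Lemma le_lebesgue_outer :
  {homo lebesgue_outer : A1 A2 / (A1 `<=` A2)%classic >-> A1 <= A2}.
Proof.
move=> A1 A2 A12; apply/ereal_inf_le_tmp => _ [B [cB A2B] <-].
by exists B => //; split => //; exact: subset_trans A12 A2B.
Qed.

Lemma esum_bigcup_le (G : (set ('rV[R]_d * 'rV[R]_d))^nat) :
  \esum_(ab in \bigcup_n G n) (box_volume ab)%:E <=
  \sum_(n <oo) \esum_(ab in G n) (box_volume ab)%:E.
Proof.
rewrite seqDU_bigcup_eq esum_bigcupT//; last exact: box_volume_ge0.
rewrite nneseries_esumT; last first.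
  by move=> n; apply: esum_ge0 => ab _; exact: box_volume_ge0.
apply: le_esum => n _; rewrite esum_mkcond [leRHS]esum_mkcond.
apply: le_esum => ab _; case: ifPn => [|_].
  by rewrite inE => -[Gnab _]; rewrite mem_set.
by case: ifPn => // _; exact: box_volume_ge0.
Qed.

Lemma lebesgue_outer_sigma_subadditive : sigma_subadditive lebesgue_outer.
Proof.
move=> A; have [[i ioo]|] := pselect (exists i, lebesgue_outer (A i) = +oo).
  rewrite (eseries_pinfty _ _ ioo) ?leey// => n _.
  by rewrite -ltNye (lt_le_trans _ (lebesgue_outer_ge0 _)).
rewrite -forallNE => Aoo.
suff add2e (e : {posnum R}) : lebesgue_outer (\bigcup_n A n) <=
    \sum_(i <oo) lebesgue_outer (A i) + e%:num%:E.
  by apply/lee_addgt0Pr => _/posnumP[].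
rewrite (le_trans _ (epsilon_trick _ _ _))//; last first.
  by move=> n; exact: lebesgue_outer_ge0.
pose P n B := box_cover (A n) B /\ \esum_(ab in B) (box_volume ab)%:E <=
  lebesgue_outer (A n) + (e%:num / (2 ^ n.+1)%:R)%:E.
have [G PG] : {G : (set ('rV[R]_d * 'rV[R]_d))^nat & forall n, P n (G n)}.
  apply: (@choice _ _ P) => n.
  have en1 : (0 < e%:num / (2 ^ n.+1)%:R :> R)%R by [].
  have fin : lebesgue_outer (A n) \is a fin_num.
    by rewrite ge0_fin_numE ?lebesgue_outer_ge0// ltey; exact/eqP/Aoo.
  have [_ [B ABn <-] ltB] := lb_ereal_inf_adherent en1 fin.
  by exists B; split => //; exact: ltW.
apply: (@le_trans _ _ (\sum_(n <oo) \esum_(ab in G n) (box_volume ab)%:E)).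
  apply: le_trans (esum_bigcup_le G); apply: ereal_inf_lbound.
  exists (\bigcup_n G n) => //; split.
    by apply: bigcup_countable => // n _; exact: (PG n).1.1.
  move=> x [n _ /(PG n).1.2[ab Gab xab]].
  by exists ab => //; exists n.
apply: lee_nneseries => n _; last exact: (PG n).2.
by move=> _; apply: esum_ge0 => ab _; exact: box_volume_ge0.
Qed.

HB.instance Definition _ := isOuterMeasure.Build R 'rV[R]_d lebesgue_outer
  lebesgue_outer0 lebesgue_outer_ge0 le_lebesgue_outer
  lebesgue_outer_sigma_subadditive.

End lebesgue_outer.

Definition lebesgue_outer_measure (R : realType) (d : nat) :
  {outer_measure set 'rV[R]_d -> \bar R} := @lebesgue_outer R d.

Definition lebesgueRn (R : realType) (d : nat) :
    {measure set (caratheodory_type (@lebesgue_outer_measure R d)) -> \bar R} :=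
  (@lebesgue_outer_measure R d :
    set (caratheodory_type (@lebesgue_outer_measure R d)) -> \bar R).

(* The sup norm carried by 'rV[R]_d in MathComp-Analysis is not Euclidean. *)
Section euclidean.
Context (R : realType) (d : nat).
Implicit Types (x : 'rV[R]_d) (A : set 'rV[R]_d) (f : 'rV[R]_d -> R).

Definition euclid_norm x : R := Num.sqrt (\sum_(i < d) x 0 i ^+ 2).

Definition euclid_ball x (delta : R) : set 'rV[R]_d :=
  [set y | euclid_norm (y - x) < delta].

Definition diam A : \bar R :=
  ereal_sup [set (euclid_norm (xy.1 - xy.2))%:E | xy in A `*` A].

Definition grad f x : 'rV[R]_d := \row_i 'D_(delta_mx 0 i) f x.

Definition C1_on (U : set 'rV[R]_d) f : Prop :=
  forall x, U x -> differentiable f x /\ {for x, continuous (grad f)}.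

End euclidean.

(* A function on Omega is represented by a function on R^d of which only the
   restriction to Omega matters. *)
Section functions_on.
Context (R : realType) (d : nat) (Omega : set 'rV[R]_d).
Implicit Types (f g : 'rV[R]_d -> R) (q : \bar R) (n : nat).

Definition supp_on f : set 'rV[R]_d := closure [set x | Omega x /\ f x != 0].

(* support of the class of f modulo almost everywhere equality *)
Definition ess_supp_on f : set 'rV[R]_d :=
  [set x | Omega x /\ forall U, nbhs x U ->
     ~ (@lebesgueRn R d).-negligible (Omega `&` U `&` [set y | f y != 0])].

Definition sup_norm f : \bar R := ereal_sup [set `|f x|%:E | x in Omega].

(* nonnegative restrictions to Omega of functions that are C^1 near Omega *)
Definition C1_nonneg f : Prop :=
  (exists U : set 'rV[R]_d, [/\ open U, Omega `<=` U & C1_on U f]) /\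
  forall x, Omega x -> 0 <= f x.

(* L^q(Omega), through extension by zero outside of Omega *)
Definition Lq_on q : set ('rV[R]_d -> R) :=
  [set f | f \_ Omega \in Lfun (@lebesgueRn R d) q].

Definition Lq_norm q f : \bar R :=
  'N[@lebesgueRn R d]_q [EFin \o (f \_ Omega)].

Definition cvg_Lq q (u : nat -> 'rV[R]_d -> R) f : Prop :=
  [/\ forall n, Lq_on q (u n), Lq_on q f
    & Lq_norm q (u n \- f) @[n --> \oo] --> 0%E].

Definition lin_comb n (c : 'I_n -> R) (b : 'I_n -> 'rV[R]_d -> R)
  : 'rV[R]_d -> R := fun x => \sum_(k < n) c k * b k x.

Definition span_on n (b : 'I_n -> 'rV[R]_d -> R) : set ('rV[R]_d -> R) :=
  [set f : 'rV[R]_d -> R | exists c, {in Omega, f =1 lin_comb c b}].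

Definition lin_indep_on n (b : 'I_n -> 'rV[R]_d -> R) : Prop :=
  forall c, {in Omega, lin_comb c b =1 cst 0} -> forall k, c k = 0.

Definition basis_on n (b : 'I_n -> 'rV[R]_d -> R)
    (W : set ('rV[R]_d -> R)) : Prop :=
  W = span_on b /\ lin_indep_on b.

End functions_on.

Section multiresolution.
Context (R : realType) (d : nat) (Omega : set 'rV[R]_d).
Implicit Types (V : nat -> set ('rV[R]_d -> R)) (f g : 'rV[R]_d -> R).

Record MRA1 V : Prop := {
  MRA1_findim : forall j, exists n, exists b : 'I_n -> 'rV[R]_d -> R,
    V j = span_on Omega b ;
  MRA1_one : V 0%N (\1_Omega) ;
  MRA1_nested : forall j, V j `<=` V j.+1 ;
  MRA1_Lq : forall (q : R) j, 1 < q -> V j `<=` Lq_on Omega q%:E ;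
  MRA1_dense : forall (q : R) f, 1 < q -> Lq_on Omega q%:E f ->
    forall e : R, 0 < e -> exists j, exists2 g, V j g &
      (Lq_norm Omega q%:E (g \- f)%R < e%:E)%E }.

(* Phi_(j-1) = A Phi_j together with the normalization
   2^(-dj/2) \sum_k phi_(j,k) = 1 forces every column of A to sum to 2^(-d/2),
   so the nonnegative matrix that is (column) stochastic is 2^(d/2) A. *)
Definition normalized_stochastic m n (A : 'M[R]_(m, n)) : Prop :=
  (forall k i, 0 <= A k i) /\
  forall i, 2 `^ (d%:R / 2) * \sum_k A k i = 1.

Definition MRA2 V : Prop :=
  exists (N : nat -> nat) (phi : forall j, 'I_(N j).+1 -> 'rV[R]_d -> R)
    (A : forall j, 'M[R]_((N j).+1, (N j.+1).+1)) (C : R) (m : nat),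
  0 < C /\ forall j : nat,
  [/\ basis_on Omega (phi j) (V j),
      forall k, C1_nonneg Omega (phi j k),
      normalized_stochastic (A j) /\
      forall k, {in Omega, phi j k =1 lin_comb (A j k) (phi j.+1)} &
      forall x, Omega x ->
        2 `^ (- (d * j)%:R / 2) * \sum_(k < (N j).+1) phi j k x = 1] /\
  [/\ forall k, (diam (supp_on Omega (phi j k)) <= (C * 2 ^- j)%:E)%E,
      forall k', (#|[set k | `[< supp_on Omega (phi j k) `&`
                                 supp_on Omega (phi j k') !=set0 >]]%SET| <= m)%N
    & forall k, (sup_norm Omega (fun x => euclid_norm (grad (phi j k) x)) <=
                 (C * 2 `^ (j%:R * (d%:R / 2 + 1)))%:E)%E].

(* P j acts on L^p(Omega) modulo almost everywhere equality and returns an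
   element of V j, a genuine function on Omega. *)
Record MRA3 (p : \bar R) V (P : nat -> ('rV[R]_d -> R) -> 'rV[R]_d -> R)
    : Prop := {
  MRA3_range : forall j f, Lq_on Omega p f -> V j (P j f) ;
  MRA3_ae : forall j f g, Lq_on Omega p f -> Lq_on Omega p g ->
    ae_eq (@lebesgueRn R d) Omega f g -> {in Omega, P j f =1 P j g} ;
  MRA3_linear : forall j (a : R) f g, Lq_on Omega p f -> Lq_on Omega p g ->
    {in Omega, P j (a \*: f \+ g) =1 a \*: P j f \+ P j g} ;
  MRA3_proj : forall j f, V j f -> {in Omega, P j f =1 f} ;
  MRA3_sup : forall j, exists K : R, forall f, Lq_on Omega p f ->
    (sup_norm Omega f < +oo)%E ->
    (sup_norm Omega (P j f) <= K%:E * sup_norm Omega f)%E ;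
  MRA3_cvg : forall f, Lq_on Omega p f ->
    cvg_Lq Omega p (fun j => P j f) f }.

End multiresolution.

Section sampling.
Context (R : realType) (d : nat) (Omega : set 'rV[R]_d).
Context (M : nat) (x : 'I_M.+1 -> 'rV[R]_d).

Definition sampling_set (Delta : R) : Prop :=
  (forall l, Omega (x l)) /\
  Omega = (\bigcup_l euclid_ball (x l) Delta^-1) `&` Omega.

(* The psi l are elements of L^oo(Omega): all conditions are understood
   almost everywhere. *)
Record partition_of (Delta : R) (psi : 'I_M.+1 -> 'rV[R]_d -> R) : Prop := {
  partition_Loo : forall l, Lq_on Omega +oo%E (psi l) ;
  partition_01 : forall l,
    {ae @lebesgueRn R d, forall y, Omega y -> 0 <= psi l y <= 1} ;
  partition_supp : forall l,
    ess_supp_on Omega (psi l) `<=` euclid_ball (x l) Delta^-1 ;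
  partition_sum :
    {ae @lebesgueRn R d, forall y, Omega y -> \sum_(l < M.+1) psi l y = 1} }.

Definition quasi_interp (psi : 'I_M.+1 -> 'rV[R]_d -> R) (f : 'rV[R]_d -> R)
  : 'rV[R]_d -> R := fun y => \sum_(l < M.+1) f (x l) * psi l y.

Fixpoint recon (P : ('rV[R]_d -> R) -> 'rV[R]_d -> R)
    (psi : 'I_M.+1 -> 'rV[R]_d -> R) (f : 'rV[R]_d -> R) (n : nat)
  : 'rV[R]_d -> R :=
  if n is n'.+1
  then P (quasi_interp psi (f \- recon P psi f n')) \+ recon P psi f n'
  else P (quasi_interp psi f).

End sampling.

(* Main.v *)
Require Import Defs.
From HB Require Import structures.
From mathcomp Require Import finmap.
From mathcomp Require Import all_boot all_order all_algebra.
From mathcomp Require Import all_classical all_reals all_analysis.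
From mathcomp Require Import ess_sup_inf measurable_realfun ring.

Import Order.TTheory GRing.Theory Num.Theory.
Import numFieldNormedType.Exports.

Local Open Scope classical_set_scope.
Local Open Scope ring_scope.

(* On V_j the error operator I - P_j Q is a contraction for the sup norm: P_j is
   the identity on V_j, so (I - P_j Q) g = P_j (g - Q g), and the sup norm of
   g - Q g is at most the oscillation of g at scale 1/Delta.  Since V_j is
   spanned by finitely many functions that are uniformly continuous on Omega,
   and the coefficients of g are controlled by its values at finitely many
   points, this oscillation is at most an arbitrarily small multiple of the sup
   norm of g once Delta is large.  Hence f_j - f_j^(n) tends to 0 geometrically
   in the sup norm, and in every L^q because Omega has finite measure. *)

(** * Finite-dimensional spaces of continuous functions on a compact set *)

Section finite_dimensional_spans.
Set Implicit Arguments.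
Unset Strict Implicit.
Context (R : realType) (d : nat) (Omega : set 'rV[R]_d).
Implicit Types (f g : 'rV[R]_d -> R).

(* Sample points for which the evaluation matrix has maximal rank determine all
   coefficients: its rank cannot grow by adding a point, so a vector in its
   kernel gives a combination vanishing on all of Omega. *)
Lemma lin_indep_sampling n (b : 'I_n -> 'rV[R]_d -> R) :
  lin_indep_on Omega b ->
  exists m (y : 'I_m -> 'rV[R]_d) (B : 'M[R]_(n, m)),
    (forall i, Omega (y i)) /\
    forall c k, c k = \sum_(i < m) B k i * lin_comb c b (y i).
Proof.
move=> indep.
pose ev m (y : 'I_m -> 'rV[R]_d) : 'M[R]_(m, n) := \matrix_(i, k) b k (y i).
pose Q (r : nat) := `[< exists m (y : 'I_m -> 'rV[R]_d),
  (forall i, Omega (y i)) /\ \rank (ev m y) = r >].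
have exQ : exists r, Q r.
  exists 0%N; apply/asboolP; exists 0%N, (fun=> 0); split; first by case.
  by apply/eqP; rewrite -leqn0 rank_leq_row.
have ubQ r : Q r -> (r <= n)%N.
  by move=> /asboolP[m [y [_ <-]]]; exact: rank_leq_col.
case: (ex_maxnP exQ ubQ) => r /asboolP[m [y [Oy ry]]] maxr.
(* A left inverse [B] of the evaluation matrix reads the coefficients off the sampled values. *)
suff /row_fullP[B BE] : row_full (ev m y).
  exists m, y, B; split => // c k.
  pose v : 'cV[R]_n := \col_i c i.
  have : (B *m ev m y *m v) k 0 = c k by rewrite BE mul1mx mxE.
  rewrite -mulmxA mxE => <-; apply: eq_bigr => i _; congr (_ * _).
  by rewrite mxE; apply: eq_bigr => l _; rewrite !mxE mulrC.
apply/negP => /negP nfull.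
have : (\rank (kermx (ev m y)^T) > 0)%N.
  rewrite mxrank_ker mxrank_tr subn_gt0 ltn_neqAle rank_leq_col andbT.
  exact: nfull.
rewrite lt0n mxrank_eq0 => /rowV0Pn[v /sub_kermxP vker v0].
case/eqP: v0; apply/rowP => k; rewrite mxE.
apply: (indep (fun k => v 0 k)) => z; rewrite inE => Oz /=.
pose y' (i : 'I_(m + 1)) :=
  match fintype.split i with inl i => y i | inr _ => z end.
have evE : ev _ y' = col_mx (ev m y) (\row_k b k z).
  apply/matrixP => i l; rewrite !mxE /y'.
  by case: (fintype.split i) => a; rewrite !mxE.
have Oy' i : Omega (y' i) by rewrite /y'; case: (fintype.split i).
have sub : ((\row_k b k z) <= ev m y)%MS.
  have le1 : (ev m y <= ev _ y')%MS by rewrite evE -addsmxE addsmxSl.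
  have : (ev _ y' <= ev m y)%MS.
    have /leqifP := mxrank_leqif_sup le1.
    case: ifP => // _; rewrite ltnNge.
    by rewrite ry maxr//; apply/asboolP; exists (m + 1)%N, y'.
  by rewrite evE col_mx_sub => /andP[].
have /submxP[D DE] := sub.
have : (\row_k b k z) *m v^T = 0.
  by rewrite DE -mulmxA -[ev m y]trmxK -trmx_mul vker trmx0 mulmx0.
move=> /matrixP/(_ 0 0); rewrite !mxE => <-.
by apply: eq_bigr => i _; rewrite !mxE mulrC.
Qed.

(** The coefficients are fixed linear combinations of finitely many values, so the sum of the
    absolute values of all entries of [B] is a constant uniform in [c]. *)
Lemma lin_indep_coef_bound n (b : 'I_n -> 'rV[R]_d -> R) :
  lin_indep_on Omega b ->
  exists2 K : R, 0 <= K & forall c (S : R),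
    (forall x, Omega x -> `|lin_comb c b x| <= S) -> forall k, `|c k| <= K * S.
Proof.
move=> /lin_indep_sampling[m [y [B [Oy cE]]]].
exists (\sum_k \sum_i `|B k i|).
  by apply: sumr_ge0 => k _; apply: sumr_ge0.
move=> c S cS k; rewrite (cE c k) (le_trans (ler_norm_sum _ _ _))//.
rewrite (bigD1 k)//= mulrDl mulr_suml.
(* Without sample points both sides are 0, whatever the sign of [S]; otherwise a sample point gives
   [0 <= S]. *)
case: m y B Oy cE => [|m] y B Oy cE.
  by rewrite !big_ord0 add0r big1 ?mul0r// => i _; rewrite big_ord0.
have S0 : 0 <= S by rewrite (le_trans _ (cS _ (Oy ord0))).
rewrite -[leLHS]addr0 lerD//.
  by apply: ler_sum => i _; rewrite normrM ler_wpM2l// cS.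
by apply: mulr_ge0 => //; apply: sumr_ge0 => i _; apply: sumr_ge0.
Qed.

Lemma coord_le_euclid_norm (x : 'rV[R]_d) i : `|x 0 i| <= euclid_norm x.
Proof.
rewrite -sqrtr_sqr ler_sqrt; last by apply: sumr_ge0 => k _; exact: sqr_ge0.
by rewrite (bigD1 i)//= lerDl; apply: sumr_ge0 => k _; exact: sqr_ge0.
Qed.

Lemma euclid_ball_sub (x y : 'rV[R]_d) e : 0 < e ->
  euclid_norm (y - x) < e -> ball x e y.
Proof.
move=> e0 yx; split=> // i j; rewrite ord1 /ball/= distrC.
by apply: le_lt_trans yx; have := coord_le_euclid_norm (y - x) j; rewrite !mxE.
Qed.

Lemma compact_unif_cts f : compact Omega ->
  (forall x, Omega x -> {for x, continuous f}) ->
  forall e, 0 < e -> exists2 delta, 0 < delta & forall x y,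
    Omega x -> Omega y -> euclid_norm (y - x) < delta -> `|f x - f y| < e.
Proof.
move=> /compact_near_coveringP cO cf e e0.
have e20 : 0 < e / 2 by rewrite divr_gt0.
pose G (t : R) (x : 'rV[R]_d) :=
  forall y, euclid_norm (y - x) < t -> `|f x - f y| < e.
(* Compactness in near-covering form turns a radius valid near each point into one valid on all of
   [Omega]. *)
have : \forall t \near 0^'+, Omega `<=` G t.
  apply: cO => x /cf /cvgrPdist_lt/(_ _ e20).
  move=> /nbhs_ballP[r /= r0 xr].
  (* With [x'] within [r / 2] of [x] and [y] within [t < r / 2] of [x'], both stay in the ball of
     radius [r] around [x]. *)
  have r20 : 0 < r / 2 by rewrite divr_gt0.
  exists (ball x (r / 2), [set t | 0 < t < r / 2]); first split => /=.
  - exact: nbhsx_ballx.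
  - near=> t; apply/andP; split; near: t; first exact: nbhs_right_gt.
    exact: nbhs_right_lt.
  - move=> [x' t] /= [xx' /andP[t0 tr]] y yx'.
    have xy : ball x r y.
      rewrite [r]splitr; apply: ball_triangle xx' _.
      by apply: le_ball (ltW tr) _ _; exact: euclid_ball_sub.
    have fxy := xr _ xy.
    have fxx' : `|f x - f x'| < e / 2.
      apply: xr; apply: le_ball xx'.
      by rewrite ler_pdivrMr// ler_peMr// ?ler1n// ltW.
    rewrite [e]splitr (le_lt_trans (ler_distD (f x) _ _))// ltrD//.
    by rewrite distrC.
move=> H; have [t [t0 tG]] := filter_ex (filterI (nbhs_right_gt (0 : R)) H).
by exists t => // x y Ox _; exact: tG.
Unshelve. all: by end_near. Qed.

Lemma compact_cts_bounded f : compact Omega ->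
  (forall x, Omega x -> {for x, continuous f}) ->
  exists2 S : R, 0 <= S & forall x, Omega x -> `|f x| <= S.
Proof.
move=> /compact_near_coveringP cO cf.
have : \forall t \near +oo%R, Omega `<=` (fun x => `|f x| <= t).
  apply: cO => x /cf /cvgrPdist_lt/(_ _ ltr01) fx.
  exists ([set y | `|f x - f y| < 1], [set t | `|f x| + 1 <= t]).
    split => //=.
    exact: nbhs_pinfty_ge.
  move=> [y t] /= [xy]; apply: le_trans.
  rewrite -lerBlDl (le_trans _ (ltW xy))// distrC.
  exact: lerB_dist.
move=> H; have [S [S0 SO]] :=
  filter_ex (filterI (nbhs_pinfty_ge (num_real (0 : R))) H).
by exists S.
Qed.

Lemma lin_comb_cts n (b : 'I_n -> 'rV[R]_d -> R) c x :
  (forall k, {for x, continuous (b k)}) -> {for x, continuous (lin_comb c b)}.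
Proof.
move=> cb; rewrite /lin_comb.
apply: (@cvg_big _ _ _ _ _ _ _ (nbhs x)) => [|k _]; first exact: add_continuous.
by apply: cvgMl_tmp; exact: cb.
Qed.

(** Bounding the coefficients by the sup norm transfers the moduli of continuity of the finitely
    many [b k] to the whole span, so one [delta] serves every [f]. *)
Lemma span_equicts n (b : 'I_n -> 'rV[R]_d -> R) : compact Omega ->
  (forall k x, Omega x -> {for x, continuous (b k)}) ->
  lin_indep_on Omega b ->
  forall e, 0 < e -> exists2 delta, 0 < delta &
    forall f (S : R), span_on Omega b f -> (forall x, Omega x -> `|f x| <= S) ->
    forall x y, Omega x -> Omega y -> euclid_norm (y - x) < delta ->
    `|f x - f y| <= e * S.
Proof.
move=> cO cb /lin_indep_coef_bound[K K0 Kb] e e0.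
(* The sum of [n] terms [K * S * e'] is then at most [e * S]; the added 1 keeps the denominator
   positive when [n] or [K] is 0. *)
pose e' := e / (n%:R * K + 1).
have den0 : 0 < n%:R * K + 1 by rewrite ltr_wpDl// mulr_ge0.
have e'0 : 0 < e' by rewrite divr_gt0.
have [dl dlP] : {dl : 'I_n -> R & forall k, 0 < dl k /\ forall x y,
    Omega x -> Omega y -> euclid_norm (y - x) < dl k -> `|b k x - b k y| < e'}.
  apply: (@choice _ _ (fun k t => 0 < t /\ forall x y,
    Omega x -> Omega y -> euclid_norm (y - x) < t ->
    `|b k x - b k y| < e')) => k.
  by have [t t0 tP] := compact_unif_cts cO (cb k) e'0; exists t.
(* The seed 1 gives a positive radius when there are no basis functions. *)
exists (\big[Num.min/1]_k dl k).
  by apply: lt_bigmin => // k _; exact: (dlP k).1.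
move=> f S [c fc] fS x y Ox Oy xy.
have S0 : 0 <= S by rewrite (le_trans _ (fS _ Ox)).
have cS k : `|c k| <= K * S.
  by apply: Kb => z Oz; rewrite -fc ?inE//; exact: fS.
rewrite !fc ?inE// /lin_comb -sumrB (le_trans (ler_norm_sum _ _ _))//.
rewrite (@le_trans _ _ (\sum_(k < n) K * S * e'))//.
  apply: ler_sum => k _; rewrite -mulrBr normrM ler_pM//.
  by apply/ltW/(dlP k).2 => //; rewrite (lt_le_trans xy)// bigmin_le_cond.
rewrite sumr_const card_ord -mulr_natl /e'.
rewrite [leLHS](_ : _ = e * S * (n%:R * K / (n%:R * K + 1))); last first.
  by field; exact: lt0r_neq0.
by rewrite ler_piMr ?mulr_ge0 ?(ltW e0)// ler_pdivrMr// mul1r lerDl.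
Qed.

End finite_dimensional_spans.

(** * Norms of bounded functions on sets of finite measure *)

(** Comparison with [B] times the indicator of [D] gives the constant: [mu D] to the power 1/q for
    finite [q], and 1 for the essential supremum. *)
Lemma Lnorm_ae_bounded (dT : measure_display) (T : measurableType dT)
    (R : realType) (mu : {measure set T -> \bar R}) (D : set T) (q : \bar R) :
  measurable D -> (mu D < +oo)%E -> (1 <= q)%E ->
  exists2 c : R, 0 <= c & forall (f : T -> R) (B : R), 0 <= B ->
    measurable_fun setT f -> {ae mu, forall x, `|f x| <= B * \1_D x} ->
    ('N[mu]_q[EFin \o f] <= (B * c)%:E)%E.
Proof.
move=> mD muD; case: q => [q q1|_|//]; last first.
  exists 1 => // f B B0 mf fB; rewrite mulr1 unlock.
  case: ifP => // _.
  apply/ess_supP; apply: filterS fB => x /= fB. rewrite lee_fin (le_trans fB)//.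
  by rewrite ler_piMr// indicE; case: (_ \in _).
have {}q1 : 1 <= q by [].
have q0 : 0 < q by rewrite (lt_le_trans ltr01).
have muDfin : mu D \is a fin_num by rewrite ge0_fin_numE.
exists (fine (mu D) `^ q^-1); first exact: powR_ge0.
move=> f B B0 mf fB; rewrite unlock.
(* Once the bound is written as a power 1/q, monotonicity reduces the claim to comparing integrals
   of q-th powers. *)
have -> : (B * fine (mu D) `^ q^-1)%:E = (((B `^ q)%:E * mu D) `^ q^-1)%E.
  rewrite -{2}(fineK muDfin) -EFinM poweR_EFin powRM ?powR_ge0 ?fine_ge0//.
  by rewrite -powRrM divff ?gt_eqF// powRr1.
rewrite gt0_ler_poweR ?invr_ge0 ?(ltW q0)//.
- by rewrite in_itv/= leey integral_ge0.
- by rewrite in_itv/= leey mule_ge0// lee_fin powR_ge0.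
have -> : ((B `^ q)%:E * mu D = \int[mu]_x ((B `^ q) * \1_D x)%:E)%E.
  under eq_integral do rewrite EFinM.
  rewrite ge0_integralZl//.
  - by rewrite integral_indic// setIT.
  - exact/measurable_EFinP.
  - by rewrite lee_fin powR_ge0.
apply: ae_ge0_le_integral => //.
- by move=> x _; rewrite poweR_ge0.
- apply: (@measurableT_comp _ _ _ _ _ _ (fun x => x `^ q)%E).
    exact: measurable_poweR.
  by apply: measurableT_comp => //; exact/measurable_EFinP.
- by move=> x _; rewrite lee_fin mulr_ge0// powR_ge0.
- by apply/measurable_EFinP; apply: measurable_funM => //; exact: measurable_cst.
apply: filterS fB => x /= fB _.
rewrite lee_fin (le_trans (ge0_ler_powR _ _ _ fB))//;
  rewrite ?nnegrE ?(ltW q0) ?mulr_ge0//.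
rewrite powRM// indicE; case: (_ \in _); rewrite ?powR1//.
by rewrite powR0 ?gt_eqF.
Qed.

(** The q-th power of an indicator is the indicator itself, so a finite norm means a finite measure;
    [D] is measurable as the preimage of 1. *)
Lemma Lfun_indic_finite (dT : measure_display) (T : measurableType dT)
    (R : realType) (mu : {measure set T -> \bar R}) (D : set T) (q : R) :
  1 <= q -> \1_D \in Lfun mu q%:E -> measurable D /\ (mu D < +oo)%E.
Proof.
move=> q1; have q0 : 0 < q by rewrite (lt_le_trans ltr01).
rewrite inE => /andP[]; rewrite !inE/= => m1 fin1.
have mD : measurable D.
  have := m1 measurableT [set 1] (measurable_set1 _).
  rewrite setTI; congr (measurable _); apply/seteqP; split => x /=.
    by rewrite indicE => /eqP; rewrite pnatr_eq1 eqb1 inE.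
  by move=> Dx; rewrite indicE mem_set.
split=> //; move: fin1; rewrite /finite_norm unlock => /lty_poweRy.
rewrite invr_eq0 gt_eqF// => /(_ isT).
have -> : mu D = (\int[mu]_x (\1_D x)%:E)%E by rewrite integral_indic ?setIT.
congr (_ < _)%E; apply: eq_integral => x _ /=; rewrite indicE.
by case: (_ \in _); rewrite ?normr1 ?powR1 ?normr0 ?powR0 ?gt_eqF.
Qed.

(** * Measurability on [Omega] and membership in its Lebesgue spaces *)

Section functions_on_finite_measure.
Set Implicit Arguments.
Unset Strict Implicit.
Context (R : realType) (d : nat) (Omega : set 'rV[R]_d).
Implicit Types (f g : 'rV[R]_d -> R).
Local Notation mu := (@lebesgueRn R d).

(** Extension by zero and the Caratheodory sigma-algebra are the form in which [Lq_on] carries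
    measurability. *)
Definition measurable_on f := measurable_fun
  [set: caratheodory_type (@lebesgue_outer_measure R d)] (f \_ Omega).

Lemma Lq_on_measurable q f : Lq_on Omega q f -> measurable_on f.
Proof. by rewrite /Lq_on/= inE => /andP[+ _]; rewrite inE. Qed.

Lemma measurable_onD f g : measurable_on f -> measurable_on g ->
  measurable_on (f \+ g).
Proof.
move=> mf mg; rewrite /measurable_on.
have -> : (f \+ g) \_ Omega = f \_ Omega \+ g \_ Omega.
  by apply/funext => x; rewrite /patch/=; case: ifP => //; rewrite addr0.
exact: measurable_funD.
Qed.

Lemma measurable_onZ a f : measurable_on f -> measurable_on (fun x => a * f x).
Proof.
move=> mf; rewrite /measurable_on.
have -> : (fun x => a * f x) \_ Omega = fun x => a * (f \_ Omega) x.
  by apply/funext => x; rewrite /patch/=; case: ifP => //; rewrite mulr0.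
exact: measurable_funM.
Qed.

Lemma measurable_onB f g : measurable_on f -> measurable_on g ->
  measurable_on (f \- g).
Proof.
move=> mf /(measurable_onZ (-1)) mg; have := measurable_onD mf mg.
by congr (measurable_on _); apply/funext => x /=; rewrite mulN1r.
Qed.

(** Truncation between [- B] and [B] fixes 0, so it commutes with extension by zero. *)
Lemma measurable_on_clip (B : R) f : 0 <= B -> measurable_on f ->
  measurable_on (fun x => Num.max (- B) (Num.min B (f x))).
Proof.
move=> B0 mf; rewrite /measurable_on.
have -> : (fun x => Num.max (- B) (Num.min B (f x))) \_ Omega =
    fun x => Num.max (- B) (Num.min B ((f \_ Omega) x)).
  apply/funext => x; rewrite /patch/=; case: ifP => //.
  by rewrite min_r// max_r// oppr_le0.
apply: (measurable_maxr (measurable_cst _)).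
exact: (measurable_minr (measurable_cst _) mf).
Qed.

Hypothesis Omega1 : Lq_on Omega 2%:E (\1_Omega).

Let Omega_restrict : (\1_Omega : 'rV[R]_d -> R) \_ Omega = \1_Omega.
Proof. by apply/funext => x; rewrite /patch indicE; case: (x \in Omega). Qed.

Let Omega_finite :
  measurable (Omega : set (caratheodory_type (@lebesgue_outer_measure R d))) /\
  (mu Omega < +oo)%E.
Proof.
move: Omega1; rewrite /Lq_on/= Omega_restrict => /Lfun_indic_finite; apply.
by rewrite ler1n.
Qed.

Lemma Lq_norm_ae_bounded q : (1 <= q)%E ->
  exists2 c : R, 0 <= c & forall f (B : R), 0 <= B ->
    measurable_on f -> {ae mu, forall x, Omega x -> `|f x| <= B} ->
    (Lq_norm Omega q f <= (B * c)%:E)%E.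
Proof.
move=> q1.
have [mO finO] := Omega_finite.
have [c c0 cP] := @Lnorm_ae_bounded _ _ _ mu Omega q mO finO q1.
exists c => // f B B0 mf fB; apply: cP => //.
apply: (@filterS _ (almost_everywhere mu)) fB => x fB; rewrite /patch indicE.
by case: ifPn => [/set_mem/fB|_]; rewrite ?mulr1 ?normr0 ?mulr0.
Qed.

Lemma Lq_on_ae_bounded q f (B : R) : (1 <= q)%E -> 0 <= B ->
  measurable_on f -> {ae mu, forall x, Omega x -> `|f x| <= B} ->
  Lq_on Omega q f.
Proof.
move=> /Lq_norm_ae_bounded[c c0 cP] B0 mf fB.
rewrite /Lq_on/= inE; apply/andP; split; rewrite inE//=.
by rewrite /finite_norm (le_lt_trans (cP _ _ B0 mf fB))// ltry.
Qed.

End functions_on_finite_measure.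

(** * Essential supports and the almost everywhere error of quasi-interpolation *)

Section quasi_interpolation.
Set Implicit Arguments.
Unset Strict Implicit.
Context (R : realType) (d : nat) (Omega : set 'rV[R]_d).
Implicit Types (f g : 'rV[R]_d -> R).
Local Notation mu := (@lebesgueRn R d).

Lemma euclid_ball_open (x : 'rV[R]_d) (r : R) : open (euclid_ball x r).
Proof.
rewrite openE => y xy; rewrite /interior/=.
pose N (z : 'rV[R]_d) := euclid_norm (z - x).
suff cN : {for y, continuous N} by exact: (cvgr_lt _ cN).
have -> : N = Num.sqrt \o fun z =>
    \sum_(i < d) (z 0 i - x 0 i) * (z 0 i - x 0 i).
  apply/funext => z; rewrite /N /euclid_norm/=; congr Num.sqrt.
  by apply: eq_bigr => i _; rewrite expr2 !mxE.
apply: continuous_comp; last exact: sqrt_continuous.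
apply: (@cvg_big _ _ _ _ _ _ _ (nbhs y)) => [|i _]; first exact: add_continuous.
suff c : {for y, continuous (fun z : 'rV[R]_d => z 0 i - x 0 i)}.
  exact: (continuousM c c).
by apply: continuousB; [exact: coord_continuous|exact: cst_continuous].
Qed.

(** Each point of [Omega] outside [U] has a neighbourhood where [f] vanishes almost everywhere on
    [Omega]; compactness leaves finitely many of these to discard. *)
Lemma ess_supp_ae (f : 'rV[R]_d -> R) (U : set 'rV[R]_d) : compact Omega ->
  open U -> ess_supp_on Omega f `<=` U ->
  {ae mu, forall y, Omega y -> f y != 0 -> U y}.
Proof.
rewrite compact_cover => cO oU fU.
pose B (W : set 'rV[R]_d) := Omega `&` W `&` [set z | f z != 0].
pose D := [set W | open W /\ (W `<=` U \/ mu.-negligible (B W))].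
have [|y Oy|D' D'D OD'] := cO _ D id; first by move=> W [].
  have [Uy|nUy] := pselect (U y); first by exists U => //; split => //; left.
  have : ~ ess_supp_on Omega f y by move/fU.
  move=> /not_andP[//|/existsNP[W /not_implyP[yW /contrapT nW]]].
  exists W^° => //; split; first exact: open_interior.
  right; apply: negligibleS nW => z [[Oz Wz] fz].
  by split => //; split => //; exact: interior_subset Wz.
have FF : Filter (almost_everywhere mu) by exact: ae_filter_ringOfSetsType.
(* For [W] inside [U] the exceptional set is empty; otherwise it lies in the negligible set
   [B W]. *)
have : almost_everywhere mu (\bigcap_(W in [set` D']) ~` (B W `&` ~` U)).
  apply: filter_bigI => W /D'D /set_mem[_ DW].
  rewrite /almost_everywhere setCK; case: DW => [WU|].
    apply: negligibleS (negligible_set0 mu) => z [[[_ Wz] _] nUz].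
    by apply: nUz; exact: WU.
  by apply: negligibleS => z [].
apply: (@filterS _ (almost_everywhere mu)) => y Ny Oy fy.
apply: contrapT => nUy.
by have [W D'W Wy] := OD' _ Oy; apply: (Ny W D'W).
Qed.

Context (M : nat) (x : 'I_M.+1 -> 'rV[R]_d).
Context (psi : 'I_M.+1 -> 'rV[R]_d -> R) (Delta : R).
Hypotheses (cO : compact Omega) (Ox : forall l, Omega (x l)).
Hypothesis part : partition_of Omega x Delta psi.

Lemma quasi_interp_measurable g : measurable_on Omega (quasi_interp x psi g).
Proof.
rewrite /measurable_on.
have -> : quasi_interp x psi g \_ Omega =
    fun y => \sum_(l < M.+1) g (x l) * (psi l \_ Omega) y.
  apply/funext => y; rewrite /patch/quasi_interp.
  by case: (y \in Omega) => //; rewrite big1// => l _; rewrite mulr0.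
apply: measurable_sum => l; apply: measurable_funM => //.
exact: Lq_on_measurable (partition_Loo part l).
Qed.

(** Since the [psi l] sum to 1, the error at [y] is the average of [g y - g (x l)] with weights
    [psi l y], and a nonzero weight puts [y] within [Delta^-1] of [x l], all up to a null set. *)
Lemma quasi_interp_ae g (E : R) :
  (forall y z, Omega y -> Omega z -> euclid_norm (z - y) < Delta^-1 ->
    `|g y - g z| <= E) ->
  {ae mu, forall y, Omega y -> `|g y - quasi_interp x psi g y| <= E}.
Proof.
move=> gE.
have FF : Filter (almost_everywhere mu) by exact: ae_filter_ringOfSetsType.
have supp : {ae mu, forall y, forall l, Omega y -> psi l y != 0 ->
    euclid_ball (x l) Delta^-1 y}.
  apply: (@filter_forall _ _ _ (almost_everywhere mu)) => l.
  apply: (ess_supp_ae cO (@euclid_ball_open _ _)).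
  exact: (partition_supp part (l := l)).
have psi01 : {ae mu, forall y, forall l, Omega y -> 0 <= psi l y <= 1}.
  apply: (@filter_forall _ _ _ (almost_everywhere mu)) => l.
  exact: partition_01 part l.
apply: (@filterS3 _ (almost_everywhere mu)) supp psi01 (partition_sum part) =>
  y supp' psi01' sum1 Oy.
rewrite -[g y]mulr1 -(sum1 Oy) mulr_sumr /quasi_interp -sumrB.
rewrite -[leRHS]mulr1 -(sum1 Oy) mulr_sumr (le_trans (ler_norm_sum _ _ _))//.
apply: ler_sum => l _; have /andP[psi0 _] := psi01' l Oy.
rewrite -mulrBl normrM (ger0_norm psi0).
have [->|psil] := eqVneq (psi l y) 0; first by rewrite !mulr0.
rewrite ler_wpM2r// distrC gE//; exact: supp'.
Qed.

End quasi_interpolation.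

(** * Contraction of the error and convergence of the iteration *)

Section reconstruction.
Set Implicit Arguments.
Unset Strict Implicit.
Context (R : realType) (d : nat) (Omega : set 'rV[R]_d) (p : R).
Context (V : nat -> set ('rV[R]_d -> R)).
Context (P : nat -> ('rV[R]_d -> R) -> ('rV[R]_d -> R)).
Hypotheses (cO : compact Omega) (p1 : 1 < p).
Hypotheses (mra1 : MRA1 Omega V) (mra2 : MRA2 Omega V).
Hypothesis mra3 : MRA3 Omega p%:E V P.
Implicit Types (f g : 'rV[R]_d -> R).
Local Notation mu := (@lebesgueRn R d).

(* That Omega is Caratheodory measurable, of finite measure, is read off
   chi_Omega in V_0, a subset of L^2. *)
Lemma MRA1_indic : Lq_on Omega 2%:E (\1_Omega).
Proof. exact: (MRA1_Lq mra1 (ltr1n _ 2) (MRA1_one mra1)). Qed.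

Lemma MRA2_basis j : exists N (b : 'I_N.+1 -> 'rV[R]_d -> R),
  basis_on Omega b (V j) /\ forall k x, Omega x -> {for x, continuous (b k)}.
Proof.
have [N [phi [A [C [m [_ /(_ j)[[Vj C1 _ _] _]]]]]]] := mra2.
exists (N j), (phi j); split => // k x Ox.
have [[U [_ OU C1U]] _] := C1 k.
by apply: differentiable_continuous; exact: (C1U _ (OU _ Ox)).1.
Qed.

Lemma MRA_sub j f g : V j f -> V j g -> V j (f \- g).
Proof.
have [N [b [[-> _] _]]] := MRA2_basis j.
move=> [c fc] [c' gc]; exists (fun k => c k - c' k) => x Ox /=.
rewrite fc// gc// /lin_comb -sumrB; apply: eq_bigr => k _.
by rewrite mulrBl.
Qed.

Lemma MRA_add j f g : V j f -> V j g -> V j (f \+ g).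
Proof.
have [N [b [[-> _] _]]] := MRA2_basis j.
move=> [c fc] [c' gc]; exists (fun k => c k + c' k) => x Ox /=.
rewrite fc// gc// /lin_comb -big_split; apply: eq_bigr => k _.
by rewrite mulrDl.
Qed.

Lemma MRA_measurable j f : V j f -> measurable_on Omega f.
Proof. by move=> /(MRA1_Lq mra1 (ltr1n _ 2)); exact: Lq_on_measurable. Qed.

Lemma MRA_bounded j f : V j f ->
  exists2 S : R, 0 <= S & forall x, Omega x -> `|f x| <= S.
Proof.
have [N [b [[-> _] cb]]] := MRA2_basis j; move=> [c fc].
have [|S S0 SP] := @compact_cts_bounded _ _ Omega (lin_comb c b) cO.
  by move=> x Ox; apply: lin_comb_cts => k; exact: cb.
by exists S => // x Ox; rewrite fc ?inE//; exact: SP.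
Qed.

Lemma bounded_Lq_on q f S : (1 <= q)%E -> measurable_on Omega f -> 0 <= S ->
  (forall x, Omega x -> `|f x| <= S) -> Lq_on Omega q f.
Proof.
move=> q1 mf S0 fS; apply: (Lq_on_ae_bounded MRA1_indic q1 S0 mf).
exact: aeW.
Qed.

(* MRA3 only bounds [P j] on functions that are bounded everywhere, whereas
   [quasi_interp] is bounded almost everywhere: the error is first truncated. *)
Lemma proj_ae_bound j : exists2 K : R, 0 <= K &
  forall h (E : R), 0 <= E -> measurable_on Omega h ->
    {ae mu, forall y, Omega y -> `|h y| <= E} ->
    forall y, Omega y -> `|P j h y| <= K * E.
Proof.
have [K KP] := MRA3_sup mra3 j.
have p1e : (1 <= p%:E)%E by rewrite lee_fin ltW.
(* The sign of the constant from [MRA3_sup] is not prescribed, so its absolute value is taken. *)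
exists `|K| => // h E E0 mh hE y Oy.
pose r x := Num.max (- E) (Num.min E (h x)).
have rE x : `|r x| <= E.
  rewrite ler_norml /r le_max lexx/= ge_max ge_min lexx/= andbT.
  by rewrite (le_trans _ E0)// oppr_le0.
have mr : measurable_on Omega r by exact: measurable_on_clip.
have Lr : Lq_on Omega p%:E r by exact: (bounded_Lq_on p1e mr E0).
have Lh : Lq_on Omega p%:E h := Lq_on_ae_bounded MRA1_indic p1e E0 mh hE.
have hr : ae_eq mu Omega h r.
  have FF : Filter (almost_everywhere mu) by exact: ae_filter_ringOfSetsType.
  apply: (@filterS _ (almost_everywhere mu)) hE => x hE Ox.
  by have := hE Ox; rewrite ler_norml => /andP[h1 h2]; rewrite /r min_r// max_r.
rewrite (MRA3_ae mra3 j Lh Lr hr) ?inE//.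
have supE : (sup_norm Omega r <= E%:E)%E.
  by apply: ge_ereal_sup => _ [x Ox <-]; rewrite lee_fin.
(* The point [y] rules out an empty [Omega], where the supremum would be [-oo]; nonnegativity allows
   passing from [K] to its absolute value. *)
have sup0 : (0 <= sup_norm Omega r)%E.
  apply: (@le_trans _ _ `|r y|%:E); first by rewrite lee_fin.
  by apply: ereal_sup_ubound; exists y.
have := KP r Lr (le_lt_trans supE (ltry _)); move=> Kr.
rewrite -lee_fin (@le_trans _ _ (sup_norm Omega (P j r)))//.
  by apply: ereal_sup_ubound; exists y.
rewrite (le_trans Kr)// EFinM (@le_trans _ _ (`|K|%:E * sup_norm Omega r)%E)//.
  by rewrite lee_wpmul2r// lee_fin ler_norm.
by rewrite lee_wpmul2l// lee_fin.
Qed.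

(** [Delta] comes from the bound on [P j] and the equicontinuity of [V j] alone, so it is fixed
    before the samples, the partition and [f]. Membership in [V j] is carried through the induction
    because the contraction estimate is proved for elements of [V j]. *)
Lemma recon_geometric j : exists2 Delta : R, 0 < Delta &
  forall M (x : 'I_M.+1 -> 'rV[R]_d) psi f, (forall l, Omega (x l)) ->
    partition_of Omega x Delta psi -> V j f ->
    exists2 S : R, 0 <= S & forall n, V j (recon x (P j) psi f n) /\
      forall y, Omega y -> `|(f \- recon x (P j) psi f n) y| <= S * 2^-1 ^+ n.
Proof.
have p1e : (1 <= p%:E)%E by rewrite lee_fin ltW.
have [K K0 KP] := proj_ae_bound j.
have [N [b [[VE indep] cb]]] := MRA2_basis j.
(* Chosen so that [K * e <= 2^-1]; adding 1 covers [K = 0]. *)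
pose e := (2 * (K + 1))^-1.
have e0 : 0 < e by rewrite invr_gt0 mulr_gt0// ltr_wpDl.
have Ke : K * e <= 2^-1.
  rewrite /e invfM mulrCA ler_piMr ?invr_ge0// ler_pdivrMr ?ltr_wpDl//.
  by rewrite mul1r lerDl.
have [delta delta0 deltaP] := span_equicts cO cb indep e0.
exists delta^-1; first by rewrite invr_gt0.
move=> M x psi f Ox part Vf.
(* Since [P j g = g], the new error is [P j] applied to [g - q], which is at most [e * S] almost
   everywhere; the factor 1/2 then comes from [K * e <= 2^-1]. *)
have contr g (S : R) : V j g -> 0 <= S -> (forall y, Omega y -> `|g y| <= S) ->
    V j (P j (quasi_interp x psi g)) /\
    forall y, Omega y -> `|(g \- P j (quasi_interp x psi g)) y| <= S * 2^-1.
  move=> Vg S0 gS; set q := quasi_interp x psi g.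
  have mg := MRA_measurable Vg.
  have mq : measurable_on Omega q by exact: quasi_interp_measurable part g.
  have eS0 : 0 <= e * S by rewrite mulr_ge0// ltW.
  have Lg : Lq_on Omega p%:E g by exact: (MRA1_Lq mra1 p1 Vg).
  have gq : {ae mu, forall y, Omega y -> `|g y - q y| <= e * S}.
    apply: (quasi_interp_ae cO Ox part) => y z; rewrite invrK.
    by apply: deltaP => //; rewrite -VE.
  (* Being within [e * S] of [g] almost everywhere, [q] is bounded by [S + e * S] almost everywhere,
     which puts it in the domain of [P j]. *)
  have Lq : Lq_on Omega p%:E q.
    have FF : Filter (almost_everywhere mu) by exact: ae_filter_ringOfSetsType.
    apply: (Lq_on_ae_bounded MRA1_indic p1e (addr_ge0 S0 eS0) mq).
    apply: (@filterS _ (almost_everywhere mu)) gq => y gq Oy.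
    rewrite -[q y](subrK (g y)) addrC (le_trans (ler_normD _ _))//.
    by rewrite lerD ?gS// distrC gq.
  split; first exact: (MRA3_range mra3 j Lq).
  move=> y Oy /=; have Oy' : y \in Omega by rewrite inE.
  have := MRA3_linear mra3 j (-1) Lq Lg Oy'; rewrite /= (MRA3_proj mra3 Vg Oy').
  rewrite scaleN1r addrC => <-.
  rewrite (@le_trans _ _ (K * (e * S)))//; last first.
    by rewrite mulrA [leRHS]mulrC ler_wpM2r.
  apply: KP => //.
    have := measurable_onB mg mq; congr (measurable_on _ _).
    by apply/funext => z /=; rewrite scaleN1r addrC.
  have FF : Filter (almost_everywhere mu) by exact: ae_filter_ringOfSetsType.
  apply: (@filterS _ (almost_everywhere mu)) gq => z gq Oz.
  by rewrite /= scaleN1r addrC gq.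
have [S S0 fS] := MRA_bounded Vf.
exists S => //; elim=> [|n [Vn IHn]] /=.
  (* The initial error is already at most half of [S]; exponent 0 asks for less. *)
  have [VP PE] := contr f S Vf S0 fS; split => // y Oy.
  have := PE y Oy; rewrite expr0 mulr1 => /le_trans; apply.
  by rewrite ler_piMr// invf_le1// ler1n.
(* The next error is the current error minus the image of that same error under quasi-interpolation
   followed by [P j], so the contraction applies to it. *)
have [||VP PE] := contr (f \- recon x (P j) psi f n) (S * 2^-1 ^+ n) _ _ IHn.
- exact: MRA_sub.
- by rewrite mulr_ge0// exprn_ge0// invr_ge0.
split; first exact: MRA_add.
move=> y Oy; rewrite exprSr mulrA; have := PE y Oy.
by rewrite /= addrAC opprD addrA.
Qed.

Lemma geometric_uniform_cvg f (u : nat -> 'rV[R]_d -> R) (S : R) :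
  (forall n y, Omega y -> `|(f \- u n) y| <= S * 2^-1 ^+ n) ->
  {uniform Omega, u @ \oo --> f}.
Proof.
move=> uf; have cS : S * 2^-1 ^+ n @[n --> \oo] --> (0 : R).
  rewrite -[X in _ --> X](mulr0 S); apply: cvgMl_tmp; apply: cvg_expr.
  by rewrite ger0_norm ?invr_ge0// invf_lt1// ltr1n.
move=> W /uniform_nbhs[E [entE EW]].
have [e /= e0 eE] : exists2 e : R, 0 < e &
    [set xy : R * R | ball xy.1 e xy.2] `<=` E.
  by move: entE; rewrite -entourage_ballE => -[e e0 ?]; exists e.
have Se : \forall n \near \oo, S * 2^-1 ^+ n < e by exact: (cvgr_lt _ cS).
apply: (@filterS _ \oo) Se => n Sn.
apply: EW => y Oy; apply: eE => /=.
exact: le_lt_trans (uf n y Oy) Sn.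
Qed.

Lemma geometric_cvg_Lq j f (u : nat -> 'rV[R]_d -> R) (S : R) q :
  (1 <= q)%E -> 0 <= S -> V j f -> (forall n, V j (u n)) ->
  (forall n y, Omega y -> `|(f \- u n) y| <= S * 2^-1 ^+ n) ->
  cvg_Lq Omega q u f.
Proof.
move=> q1 S0 Vf Vu uf.
(* Boundedness on a set of finite measure also covers [q = 1] and [q = +oo], outside the range of
   [MRA1_Lq]. *)
have LV g : V j g -> Lq_on Omega q g.
  move=> Vg; have [B B0 gB] := MRA_bounded Vg.
  exact: (bounded_Lq_on q1 (MRA_measurable Vg) B0 gB).
split; [by move=> n; exact: LV|exact: LV|].
have [c c0 cP] := Lq_norm_ae_bounded MRA1_indic q1.
have cS : (S * 2^-1 ^+ n * c)%:E @[n --> \oo] --> 0%E.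
  apply: cvg_EFin; first exact: nearW.
  rewrite -[X in _ --> X](mul0r c); apply: cvgMr_tmp.
  rewrite -[X in _ --> X](mulr0 S); apply: cvgMl_tmp; apply: cvg_expr.
  by rewrite ger0_norm ?invr_ge0// invf_lt1// ltr1n.
apply: squeeze_cvge (cvg_cst 0%E) cS; apply: nearW => n.
rewrite Lnorm_ge0/=; apply: cP.
- by rewrite mulr_ge0// exprn_ge0// invr_ge0.
- apply: measurable_onB; first exact: MRA_measurable (Vu n).
  exact: MRA_measurable Vf.
- by apply: aeW => y Oy /=; rewrite distrC uf.
Qed.

End reconstruction.

(** * Choice of the densities and the iterated limit *)

Theorem theorem2p2 (R : realType) (d : nat) (Omega : set 'rV[R]_d) (p : R)
    (V : nat -> set ('rV[R]_d -> R))
    (P : nat -> ('rV[R]_d -> R) -> ('rV[R]_d -> R)) :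
  compact Omega -> 1 < p ->
  MRA1 Omega V -> MRA2 Omega V -> MRA3 Omega p%:E V P ->
  exists Delta : nat -> R,
  [/\ forall j, 0 < Delta j,
      forall (j M : nat) (x : 'I_M.+1 -> 'rV[R]_d)
             (psi : 'I_M.+1 -> 'rV[R]_d -> R) (f : 'rV[R]_d -> R),
        sampling_set Omega x (Delta j) ->
        partition_of Omega x (Delta j) psi ->
        V j f ->
        {uniform Omega, (fun n => recon x (P j) psi f n) @ \oo --> f} /\
        forall q : \bar R, (1 <= q)%E ->
          cvg_Lq Omega q (recon x (P j) psi f) f
    & forall (M : nat -> nat) (x : forall j, 'I_(M j).+1 -> 'rV[R]_d)
             (psi : forall j, 'I_(M j).+1 -> 'rV[R]_d -> R),
        (forall j, sampling_set Omega (x j) (Delta j)) ->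
        (forall j, partition_of Omega (x j) (Delta j) (psi j)) ->
        forall f, Lq_on Omega p%:E f ->
        exists g : nat -> 'rV[R]_d -> R,
          (forall j, cvg_Lq Omega p%:E
                       (recon (x j) (P j) (psi j) (P j f)) (g j)) /\
          cvg_Lq Omega p%:E g f].
Proof.
move=> cO p1 mra1 mra2 mra3.
have [Delta DeltaP] := choice (fun j =>
  (exists2P _ _).1 (recon_geometric cO p1 mra1 mra2 mra3 j)).
have recover (j M : nat) (x : 'I_M.+1 -> 'rV[R]_d)
    (psi : 'I_M.+1 -> 'rV[R]_d -> R) (f : 'rV[R]_d -> R) :
    sampling_set Omega x (Delta j) -> partition_of Omega x (Delta j) psi ->
    V j f ->
    {uniform Omega, (fun n => recon x (P j) psi f n) @ \oo --> f} /\
    forall q : \bar R, (1 <= q)%E -> cvg_Lq Omega q (recon x (P j) psi f) f.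
  move=> [Ox _] part Vf.
  have [S S0 SP] := (DeltaP j).2 M x psi f Ox part Vf.
  split; first by apply: geometric_uniform_cvg => n; exact: (SP n).2.
  move=> q q1; apply: (geometric_cvg_Lq cO mra1 mra2 q1 S0 Vf) => n.
    exact: (SP n).1.
  exact: (SP n).2.
exists Delta; split => [j||]; [exact: (DeltaP j).1|exact: recover|].
(* The inner limit is [P j f], an element of [V j] and hence recovered by the iteration; the outer
   limit is the convergence of the projectors in [MRA3_cvg]. *)
move=> M x psi Ox part f Lf; exists (fun j => P j f); split.
  move=> j; apply: (recover _ _ _ _ _ (Ox j) (part j) _).2.
    exact: (MRA3_range mra3 j Lf).
  by rewrite lee_fin ltW.
exact: (MRA3_cvg mra3 Lf).
Qed.
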